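(* Let $\mathbf u=(u^1,\dots,u^n)^{\intercal}$ be a vector of dependent variables. The operator $$\Re=D_x^2+\langle\mathbf u,\mathbf u\rangle+\mathbf u_1D_x^{-1}\langle\mathbf u,\cdot\rangle-\sum_{1\le i<j\le n}J_{ij}\mathbf u\,D_x^{-1}\langle J_{ij}\mathbf u_1,\cdot\rangle$$ is hereditary.
   Context: $D_x$ is the total $x$-derivative, $\mathbf u_1=D_x\mathbf u$, and $D_x^{-1}$ is the formal inverse of $D_x$ (integration constants zero); $\langle\cdot,\cdot\rangle$ is the standard inner product on $\mathbb R^n$. $J_{ij}$ is the antisymmetric $n\times n$ matrix $(J_{ij})_{kl}=\delta_{ik}\delta_{jl}-\delta_{il}\delta_{jk}$. The operator acts on $n$-vectors by $\Re P=D_x^2P+\langle\mathbf u,\mathbf u\rangle P+\mathbf u_1D_x^{-1}(\langle\mathbf u,P\rangle)-\sum_{i<j}J_{ij}\mathbf u\,D_x^{-1}(\langle J_{ij}\mathbf u_1,P\rangle)$. With the Fréchet derivative $D_\Re[P]=\frac{d}{d\epsilon}\big|_{\epsilon=0}\Re(\mathbf u+\epsilon P)$, $\Re$ is called hereditary if $\Re\,D_\Re[P](Q)-D_\Re[\Re P](Q)$ is symmetric with respect to the vectors $P$ and $Q$. *)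

(* Defs.v *)
From HB Require Import structures.
From mathcomp Require Import all_boot all_order all_algebra.

Set Implicit Arguments.
Unset Strict Implicit.
Unset Printing Implicit Defensive.

Import Order.TTheory GRing.Theory Num.Theory.
Local Open Scope ring_scope.

(* A is an algebra of (possibly nonlocal) differential functions, D the total
   x-derivative, cst the constant term (the value at zero of all dependent
   variables, their derivatives and the nonlocal variables), and I = D_x^{-1}.
   The functions have no explicit dependence on x (cst_deriv).  Since D kills
   the constants, D I = I D = id cannot hold on all of A: it is required on the
   functions without constant term, on which fixing the integration constants
   to zero (cst_int) makes I the inverse of D.  The values of I outside the
   kernel of cst are irrelevant. *)
Record formal_integration (K : numFieldType) (A : comAlgType K)
    (cst : {lrmorphism A -> K | *%R}) (D I : {linear A -> A}) : Prop :=
  FormalIntegration {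
    deriv_leibniz : forall f g : A, D (f * g) = D f * g + f * D g;
    cst_deriv : forall f : A, cst (D f) = 0;
    cst_int : forall f : A, cst f = 0 -> cst (I f) = 0;
    deriv_intK : forall f : A, cst f = 0 -> D (I f) = f;
    int_derivK : forall f : A, cst f = 0 -> I (D f) = f
  }.

Definition inner (A : comNzRingType) (n : nat) (v w : 'cV[A]_n) : A :=
  \sum_(k < n) v k 0 * w k 0.

Definition Jmx (A : comNzRingType) (n : nat) (i j : 'I_n) : 'M[A]_n :=
  \matrix_(k, l) ((i == k)%:R * (j == l)%:R - (i == l)%:R * (j == k)%:R).

(* The expression of an operator depending on u, at u and applied to P, uniform
   in the ring so that u may be replaced by u + epsilon P. *)
Definition operator_expr (n : nat) : Type :=
  forall A : comNzRingType, (A -> A) -> (A -> A) ->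
    'cV[A]_n -> 'cV[A]_n -> 'cV[A]_n.

Definition recursion_op (n : nat) : operator_expr n :=
  fun A D I u P =>
    let u1 := map_mx D u in
    map_mx D (map_mx D P) + inner u u *: P + I (inner u P) *: u1
    - \sum_(i < n) \sum_(j < n | (i < j)%N)
        I (inner (Jmx A i j *m u1) P) *: (Jmx A i j *m u).

Section Hereditary.

Variables (n : nat) (Rop : operator_expr n).
Variables (A : comNzRingType) (D I : A -> A) (u : 'cV[A]_n).

(* D_Rop[P](Q), the derivative at epsilon = 0 of Rop(u + epsilon P)(Q) with Q
   fixed; epsilon is the variable of {poly A}, over which D and I act
   coefficientwise. *)
Definition frechet (P Q : 'cV[A]_n) : 'cV[A]_n :=
  map_mx (fun p : {poly A} => (p^`()).[0])
    (Rop (map_poly D) (map_poly I)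
       (map_mx polyC u + 'X *: map_mx polyC P) (map_mx polyC Q)).

Definition hereditary_expr (P Q : 'cV[A]_n) : 'cV[A]_n :=
  Rop D I u (frechet P Q) - frechet (Rop D I u P) Q.

End Hereditary.

(* P and Q range over the vectors on whose components I is the inverse of D. *)
Definition hereditary (n : nat) (Rop : operator_expr n) (K : numFieldType)
    (A : comAlgType K) (cst : {lrmorphism A -> K | *%R}) (D I : {linear A -> A})
    (u : 'cV[A]_n) : Prop :=
  forall P Q : 'cV[A]_n, map_mx cst P = 0 -> map_mx cst Q = 0 ->
    hereditary_expr Rop D I u P Q = hereditary_expr Rop D I u Q P.

(* Main.v *)
Require Import Defs.
From mathcomp Require Import all_boot all_order all_algebra.
From mathcomp Require Import ring.

Set Implicit Arguments.
Unset Strict Implicit.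
Unset Printing Implicit Defensive.

Import Order.TTheory GRing.Theory Num.Theory.
Local Open Scope ring_scope.

(** Write [R P] for the operator at [u] applied to [P], [u_x] for the derivative
    of [u], and [x /\ y] for the bivector [wedge x y = x y^T - y x^T].  The sum
    over [i < j] is the expansion of a single alternating matrix in a basis
    ([sum_Jmx]), so that [recursion_opE] reads

      [R P = P_xx + <u,u> P + I<u,P> u_x - I(P /\ u_x) u].

    The derivative of [R] follows by the chain rule ([frechetE]).  Hereditariness
    says that

      [R (D_R[P] Q - D_R[Q] P) = D_R[R P] Q - D_R[R Q] P].

    Let [H] be the argument of [R] on the left.  By one integration by parts it
    contains no integrals other than [I<u,P>], [I(P /\ u_x)] and their analogues
    for [Q] ([frechet_commutatorE]).  Integrals of expressions that themselves
    contain integrals occur in the equation only through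

      [I(<u,H> - <R P,Q> + <R Q,P>) u_x] and
      [I(H /\ u_x - Q /\ (R P)_x + P /\ (R Q)_x) u].

    Both integrands are total derivatives: [D_scalar_potential] and
    [d_matrix_potential] give primitives that are polynomial in the vectors, their
    derivatives and the four basic integrals.  The crucial term of the matrix
    primitive is the commutator of [I(P /\ u_x)] and [I(Q /\ u_x)]; it works because
    skew matrices act on bivectors by commutation, as derivations
    ([commutator_wedge]).  After substituting the primitives, the equation is an
    identity between differential polynomials ([potentials_cancel]).

    As [u], [P] and [Q] have no constant term, neither do the expressions under
    the integral signs nor the primitives, so that differentiation and integration
    are inverse to each other wherever they meet. *)

(** * Inner products and alternating matrices *)

Definition wedge (A : comNzRingType) (n : nat) (x y : 'cV[A]_n) : 'M[A]_n :=
  \matrix_(i, j) (x i 0 * y j 0 - y i 0 * x j 0).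

Section Vectors.

Variables (A : comNzRingType) (n : nat).
Implicit Types (x y z : 'cV[A]_n) (W M : 'M[A]_n).

Lemma innerE x y : inner x y = (x^T *m y) 0 0.
Proof. by rewrite mxE; apply: eq_bigr => k _; rewrite mxE. Qed.

Lemma innerC x y : inner x y = inner y x.
Proof. by apply: eq_bigr => k _; rewrite mulrC. Qed.

Lemma innerDr x y z : inner x (y + z) = inner x y + inner x z.
Proof. by rewrite !innerE mulmxDr mxE. Qed.

Lemma innerNr x y : inner x (- y) = - inner x y.
Proof. by rewrite !innerE mulmxN mxE. Qed.

Lemma innerZr a x y : inner x (a *: y) = a * inner x y.
Proof. by rewrite !innerE -scalemxAr mxE. Qed.

Lemma inner_skew W x y : W^T = - W -> inner x (W *m y) = - inner y (W *m x).
Proof.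
move=> skewW; rewrite innerC !innerE trmx_mul skewW.
by rewrite mulmxN mulNmx mulmxA mxE.
Qed.

Lemma wedgeE x y i j : wedge x y i j = x i 0 * y j 0 - y i 0 * x j 0.
Proof. by rewrite mxE. Qed.

Lemma wedge_mulmx x y : wedge x y = x *m y^T - y *m x^T.
Proof. by apply/matrixP=> i j; rewrite !mxE !big_ord1 !mxE. Qed.

Lemma tr_wedge x y : (wedge x y)^T = - wedge x y.
Proof. by rewrite wedge_mulmx linearB /= !trmx_mul !trmxK opprB. Qed.

Lemma mul_wedge x y z : wedge x y *m z = inner y z *: x - inner x z *: y.
Proof.
by rewrite wedge_mulmx mulmxBl -!mulmxA [y^T *m z]mx11_scalar [x^T *m z]mx11_scalar
  !mul_mx_scalar -!innerE.
Qed.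

(** A skew matrix is an infinitesimal rotation, so it acts on bivectors, by
    commutation, as a derivation of the wedge product. *)
Lemma commutator_wedge W x y : W^T = - W ->
  W *m wedge x y - wedge x y *m W = wedge (W *m x) y + wedge x (W *m y).
Proof.
move=> skewW; rewrite !wedge_mulmx.
have -> : (x *m y^T - y *m x^T) *m W = y *m (W *m x)^T - x *m (W *m y)^T.
  by rewrite !trmx_mul skewW !mulmxN mulmxBl -!mulmxA opprK addrC.
by rewrite mulmxBr !mulmxA opprB addrACA [RHS]addrACA [_ + x *m _]addrC
  [- (W *m y *m _) + _]addrC.
Qed.

Lemma Jmx_delta (i j : 'I_n) : Jmx A i j = delta_mx i j - delta_mx j i.
Proof.
apply/matrixP=> k l; rewrite !mxE -!natrM !mulnb.
by rewrite ![k == _]eq_sym ![l == _]eq_sym [(j == k) && _]andbC.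
Qed.

(** The [Jmx A i j] with [i < j] form a basis of the alternating matrices, and
    the coordinates are the entries above the diagonal.  Over a ring where 2
    may vanish, skewness does not force the diagonal to be zero. *)
Lemma sum_Jmx W : W^T = - W -> (forall i, W i i = 0) ->
  \sum_(i < n) \sum_(j < n | (i < j)%N) W i j *: Jmx A i j = W.
Proof.
move=> skewW diagW; pose E i j := W i j *: (delta_mx i j : 'M[A]_n).
have JE i j : W i j *: Jmx A i j = E i j + E j i.
  have WE : W j i = - W i j.
    by move/matrixP: skewW => /(_ i j); rewrite !mxE.
  by rewrite /E WE scaleNr -scalerBr Jmx_delta.
rewrite [RHS]matrix_sum_delta.
under eq_bigr => i _ do under eq_bigr => j _ do rewrite JE.
under eq_bigr => i _ do rewrite big_split /=.
rewrite big_split /= [X in _ + X](exchange_big_dep xpredT) //= -big_split /=.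
apply: eq_bigr => i _; rewrite [RHS](bigID (fun j : 'I_n => (i < j)%N)) /=.
congr (_ + _); rewrite [RHS](bigD1 i) ?ltnn //= diagW scale0r add0r.
by apply: eq_bigl => j; rewrite -leqNgt ltn_neqAle andbC.
Qed.

End Vectors.

(** * The operator in terms of the wedge product *)

Section RecursionOp.

Variables (A : comNzRingType) (n : nat) (D I : {additive A -> A}).
Implicit Types u P : 'cV[A]_n.

(** The sum over [i < j] of the nonlocal rotations is the expansion, in the
    basis of the [Jmx A i j], of one alternating matrix: the integral of
    [wedge P u_x]. *)
Lemma recursion_opE u P :
  recursion_op D I u P =
    map_mx D (map_mx D P) + inner u u *: P + I (inner u P) *: map_mx D u
    - map_mx I (wedge P (map_mx D u)) *m u.
Proof.
rewrite /recursion_op; congr (_ - _); set u1 := map_mx D u.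
set W := map_mx I _.
have skewW : W^T = - W by rewrite /W map_trmx tr_wedge map_mxN.
have diagW i : W i i = 0 by rewrite mxE wedgeE mulrC subrr raddf0.
rewrite -[in RHS](sum_Jmx skewW diagW) mulmx_suml.
apply: eq_bigr => i _; rewrite mulmx_suml; apply: eq_bigr => j _.
rewrite -scalemxAl; congr (_ *: _); rewrite mxE; congr (I _).
rewrite wedgeE Jmx_delta.
have dE (k l : 'I_n) : inner (delta_mx k l *m u1) P = u1 l 0 * P k 0.
  rewrite /inner (bigD1 k) //= big1 => [|m nmk].
    rewrite addr0 mxE (bigD1 l) //= big1 => [|q nql].
      by rewrite mxE !eqxx mul1r addr0.
    by rewrite mxE (negPf nql) andbF mul0r.
  rewrite mxE big1 ?mul0r // => q _.
  by rewrite mxE (negPf nmk) mul0r.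
by rewrite mulmxBl innerC innerDr innerNr ![inner P _]innerC !dE; ring.
Qed.

Lemma recursion_opB u P Q :
  recursion_op D I u P - recursion_op D I u Q = recursion_op D I u (P - Q).
Proof.
rewrite !recursion_opE !map_mxB innerDr innerNr raddfB.
have -> : wedge (P - Q) (map_mx D u) =
    wedge P (map_mx D u) - wedge Q (map_mx D u).
  by apply/matrixP=> i j; rewrite !mxE; ring.
rewrite map_mxB mulmxBl.
move: (_ *m u) (_ *m u) => v w.
by apply/matrixP=> i j; rewrite !mxE; ring.
Qed.

End RecursionOp.

(** * Derivations along a morphism *)

(** With [g] the identity, [f] is a derivation such as the total derivative;
    with [g] and [f] the coefficients of degree 0 and 1 of polynomials, the same
    rules compute a derivative in epsilon at 0. *)
Section Derivation.

Variables (A B : comNzRingType) (g f : {additive A -> B}).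
Hypothesis fM : forall a b, f (a * b) = f a * g b + g a * f b.

Lemma derivation_mulmx m n p (M : 'M[A]_(m, n)) (N : 'M[A]_(n, p)) :
  map_mx f (M *m N) = map_mx f M *m map_mx g N + map_mx g M *m map_mx f N.
Proof.
apply/matrixP=> i j; rewrite !mxE raddf_sum -big_split /=.
by apply: eq_bigr => k _; rewrite fM !mxE.
Qed.

Lemma derivation_scalemx n a (x : 'cV[A]_n) :
  map_mx f (a *: x) = f a *: map_mx g x + g a *: map_mx f x.
Proof. by apply/matrixP=> i j; rewrite !mxE fM. Qed.

Lemma derivation_inner n (x y : 'cV[A]_n) :
  f (inner x y) = inner (map_mx f x) (map_mx g y)
                + inner (map_mx g x) (map_mx f y).
Proof.
rewrite raddf_sum -big_split /=.
by apply: eq_bigr => k _; rewrite fM !mxE.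
Qed.

Lemma derivation_wedge n (x y : 'cV[A]_n) :
  map_mx f (wedge x y) = wedge (map_mx f x) (map_mx g y)
                       + wedge (map_mx g x) (map_mx f y).
Proof.
by apply/matrixP=> i j; rewrite !mxE raddfB !fM; ring.
Qed.

End Derivation.

Section Morphism.

Variables (A B : comNzRingType) (g : {rmorphism A -> B}) (n : nat).

Lemma map_inner (x y : 'cV[A]_n) :
  g (inner x y) = inner (map_mx g x) (map_mx g y).
Proof. by rewrite rmorph_sum; apply: eq_bigr => k _; rewrite rmorphM !mxE. Qed.

Lemma map_wedge (x y : 'cV[A]_n) :
  map_mx g (wedge x y) = wedge (map_mx g x) (map_mx g y).
Proof. by apply/matrixP=> i j; rewrite !mxE rmorphB !rmorphM. Qed.

End Morphism.

(** * The Frechet derivative of the operator *)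

(** The chain rule for the operator, with [V] constant to first order because the
    argument is held fixed while [u] varies.  The rule is stated for an abstract
    pair [(g, f)], which the coefficients of degree 0 and 1 then instantiate. *)
Lemma derivation_recursion_op (A B : comNzRingType) (n : nat)
    (g : {rmorphism A -> B}) (f : {additive A -> B})
    (DA IA : {additive A -> A}) (D I : {additive B -> B})
    (fM : forall a b, f (a * b) = f a * g b + g a * f b)
    (gD : forall a, g (DA a) = D (g a)) (fD : forall a, f (DA a) = D (f a))
    (gI : forall a, g (IA a) = I (g a)) (fI : forall a, f (IA a) = I (f a))
    (u P Q : 'cV[B]_n) (U V : 'cV[A]_n) :
    map_mx g U = u -> map_mx f U = P -> map_mx g V = Q -> map_mx f V = 0 ->
  map_mx f (recursion_op DA IA U V) =
    (inner u P *+ 2) *: Q + I (inner P Q) *: map_mx D u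
    + I (inner u Q) *: map_mx D P
    - map_mx I (wedge Q (map_mx D P)) *m u
    - map_mx I (wedge Q (map_mx D u)) *m P.
Proof.
move=> gU fU gV fV.
have map_commute (h : A -> B) (hA : A -> A) (hB : B -> B) m p
    (M : 'M[A]_(m, p)) :
    (forall a, h (hA a) = hB (h a)) ->
  map_mx h (map_mx hA M) = map_mx hB (map_mx h M).
  by move=> hC; apply/matrixP=> i j; rewrite !mxE hC.
rewrite recursion_opE map_mxB !map_mxD (derivation_mulmx fM).
rewrite !(derivation_scalemx fM) /= gI fI !map_inner !(derivation_inner fM) /=.
rewrite !(map_commute _ _ _ _ _ _ gI, map_commute _ _ _ _ _ _ fI).
rewrite map_wedge (derivation_wedge fM) /=.
rewrite !(map_commute _ _ _ _ _ _ gD, map_commute _ _ _ _ _ _ fD) gU fU gV fV.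
rewrite !map_mx0 scaler0 addr0.
have -> : inner u 0 = 0 by rewrite innerE mulmx0 mxE.
rewrite addr0.
have -> : wedge 0 (map_mx D u) = 0.
  by apply/matrixP=> i j; rewrite !mxE mul0r mulr0 subr0.
by rewrite !add0r (innerC P u) -mulr2n opprD !addrA.
Qed.

Lemma frechetE (A : comNzRingType) (n : nat) (D I : {additive A -> A})
    (u P Q : 'cV[A]_n) :
  frechet (@recursion_op n) D I u P Q =
    (inner u P *+ 2) *: Q + I (inner P Q) *: map_mx D u
    + I (inner u Q) *: map_mx D P
    - map_mx I (wedge Q (map_mx D P)) *m u
    - map_mx I (wedge Q (map_mx D u)) *m P.
Proof.
have -> : frechet (@recursion_op n) D I u P Q = map_mx (coefp 1)
    (recursion_op (map_poly D) (map_poly I)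
       (map_mx polyC u + 'X *: map_mx polyC P) (map_mx polyC Q)).
  by apply/matrixP=> i j; rewrite !mxE horner_coef0 coef_deriv.
have coef1M (p q : {poly A}) :
    coefp 1 (p * q) = coefp 1 p * coefp 0 q + coefp 0 p * coefp 1 q.
  by rewrite /= coefM !big_ord_recl big_ord0 addr0 addrC.
have coef_comm (h : {additive A -> A}) i (p : {poly A}) :
    coefp i (map_poly h p) = h (coefp i p) by rewrite /= coef_map.
apply: (derivation_recursion_op coef1M (coef_comm D 0) (coef_comm D 1)
  (coef_comm I 0) (coef_comm I 1)); apply/matrixP=> i j;
  by rewrite !mxE /= ?(coefD, coefXM) !coefC /= ?(addr0, add0r).
Qed.

(** * The local identities *)

(** Here the nonlocal expressions are free unknowns, known only through their
    derivatives: [s] and [V] stand for the integrals of [inner u P] and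
    [wedge P u_x], and [t] and [W] for those of [inner u Q] and [wedge Q u_x].
    What remains of the theorem is then three identities between differential
    polynomials. *)
Section DifferentialIdentities.

Variables (A : comNzRingType) (n : nat) (D : {additive A -> A}).
Hypothesis DM : forall a b : A, D (a * b) = D a * b + a * D b.
Variables (u P Q : 'cV[A]_n) (s t : A) (V W : 'M[A]_n).
Local Notation d := (map_mx D).
Hypotheses (Ds : D s = inner u P) (Dt : D t = inner u Q).
Hypotheses (dV : d V = wedge P (d u)) (dW : d W = wedge Q (d u)).
Hypotheses (skewV : V^T = - V) (skewW : W^T = - W).

Let dD m p (M N : 'M[A]_(m, p)) : d (M + N) = d M + d N.
Proof. exact: map_mxD. Qed.

Let dN m p (M : 'M[A]_(m, p)) : d (- M) = - d M.
Proof. exact: map_mxN. Qed.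

Let dM m p q (M : 'M[A]_(m, p)) (N : 'M[A]_(p, q)) :
  d (M *m N) = d M *m N + M *m d N.
Proof. by rewrite (@derivation_mulmx _ _ idfun D) //= !(map_mx_id (frefl id)). Qed.

Let dZ a (x : 'cV[A]_n) : d (a *: x) = D a *: x + a *: d x.
Proof. by rewrite (@derivation_scalemx _ _ idfun D) //= !(map_mx_id (frefl id)). Qed.

Let d_wedge (x y : 'cV[A]_n) : d (wedge x y) = wedge (d x) y + wedge x (d y).
Proof. by rewrite (@derivation_wedge _ _ idfun D) //= !(map_mx_id (frefl id)). Qed.

Let D_inner (x y : 'cV[A]_n) : D (inner x y) = inner (d x) y + inner x (d y).
Proof. by rewrite (@derivation_inner _ _ idfun D) //= !(map_mx_id (frefl id)). Qed.

Definition recursion_with_potentials (x : 'cV[A]_n) (a : A) (M : 'M[A]_n) :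
    'cV[A]_n :=
  d (d x) + inner u u *: x + a *: d u - M *m u.

Let GP := recursion_with_potentials P s V.
Let GQ := recursion_with_potentials Q t W.

(** This is [frechet P Q - frechet Q P].  Only [s], [t], [V] and [W] occur: the
    integral of [inner P Q] is symmetric, and the integrals of [wedge Q P_x] and
    [wedge P Q_x] differ by the local term [wedge Q P], whose action on [u] halves
    the coefficients of [Q] and [P]. *)
Definition frechet_commutator : 'cV[A]_n :=
  inner u P *: Q - inner u Q *: P + t *: d P - s *: d Q - W *m P + V *m Q.

Definition scalar_potential : A :=
  t * inner u P - s * inner u Q - inner (d P) Q + inner (d Q) P.

Definition matrix_potential : 'M[A]_n :=
  V *m W - W *m V - inner u u *: wedge Q P + wedge (d Q) (d P)
  - wedge Q (d (d P)) + wedge P (d (d Q)) - s *: wedge Q (d u)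
  + t *: wedge P (d u).

Let H := frechet_commutator.

(** In the antisymmetrized hereditary expression, the coefficient of [u_x] under
    the integral sign is a total derivative.  The skewness of [V] and [W] cancels
    the terms in which they occur. *)
Lemma D_scalar_potential :
  D scalar_potential = inner u H - (inner GP Q - inner GQ P).
Proof.
rewrite /H /scalar_potential /frechet_commutator /GP /GQ /recursion_with_potentials.
rewrite !(innerC _ Q) !(innerC _ P).
rewrite !(innerDr, innerNr, innerZr).
rewrite (inner_skew Q u skewV) (inner_skew P u skewW).
rewrite !(raddfD D, raddfN D) /= !(DM, D_inner) Ds Dt.
rewrite (innerC (d P) u) (innerC (d Q) u) (innerC (d Q) (d P)).
rewrite !(innerC Q) !(innerC P).
ring.
Qed.

(** The same for the integrand of the rotation applied to [u].  The terms
    quadratic in the matrix unknowns are the derivative of their commutator, by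
    [commutator_wedge]. *)
Lemma d_matrix_potential :
  d matrix_potential = wedge H (d u) - (wedge Q (d GP) - wedge P (d GQ)).
Proof.
(* The commutator is isolated since its derivative is not computed entrywise. *)
have -> : matrix_potential = V *m W - W *m V
    + (wedge (d Q) (d P) - wedge Q (d (d P)) + wedge P (d (d Q))
       - inner u u *: wedge Q P - s *: wedge Q (d u) + t *: wedge P (d u)).
  by apply/matrixP=> i j; rewrite !mxE; ring.
have dcomm : d (V *m W - W *m V) =
    (wedge (V *m Q) (d u) + wedge Q (V *m d u))
    - (wedge (W *m P) (d u) + wedge P (W *m d u)).
  rewrite -!commutator_wedge // dD dN !dM dV dW.
  by apply/matrixP=> i j; rewrite !mxE; ring.
have dWu : d (W *m u) = inner (d u) u *: Q - inner Q u *: d u + W *m d u.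
  by rewrite dM dW mul_wedge.
have dVu : d (V *m u) = inner (d u) u *: P - inner P u *: d u + V *m d u.
  by rewrite dM dV mul_wedge.
rewrite dD dcomm /GP /GQ /recursion_with_potentials /H /frechet_commutator.
rewrite !(dD, dN) dVu dWu.
(* The remaining matrix products are atoms of an entrywise ring identity. *)
move: (V *m d u) (W *m d u) (V *m Q) (W *m P) => x1 x2 x3 x4.
rewrite !dZ !D_inner Ds Dt !(innerC _ u).
apply/matrixP=> i j; rewrite !mxE !(raddfB D, raddfD D) /= !DM !raddfB /= !DM.
rewrite D_inner Ds Dt !(innerC _ u).
ring.
Qed.

(** Once the two integrals are replaced by their potentials, the antisymmetrized
    hereditary expression has no integrals of integrals left; this is its
    vanishing. *)
Lemma potentials_cancel :
  d (d H) + inner u u *: H + scalar_potential *: d u - matrix_potential *m u =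
  (inner u GP *+ 2) *: Q - (inner u GQ *+ 2) *: P + t *: d GP - s *: d GQ
  - W *m GP + V *m GQ.
Proof.
have dWu : d (W *m u) = inner (d u) u *: Q - inner Q u *: d u + W *m d u.
  by rewrite dM dW mul_wedge.
have dVu : d (V *m u) = inner (d u) u *: P - inner P u *: d u + V *m d u.
  by rewrite dM dV mul_wedge.
have ddWP : d (d (W *m P)) =
    d (wedge Q (d u)) *m P + wedge Q (d u) *m d P *+ 2 + W *m d (d P).
  by rewrite dM dW dD !dM dW mulr2n !addrA.
have ddVQ : d (d (V *m Q)) =
    d (wedge P (d u)) *m Q + wedge P (d u) *m d Q *+ 2 + V *m d (d Q).
  by rewrite dM dV dD !dM dV mulr2n !addrA.
rewrite /matrix_potential !(mulmxDl, mulNmx) -!scalemxAl -!mulmxA !mul_wedge.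
rewrite /H /frechet_commutator !(dD, dN) ddWP ddVQ !d_wedge.
rewrite !mulmxDl !mul_wedge.
rewrite /GP /GQ /recursion_with_potentials /scalar_potential.
rewrite ?(dD, dN) dVu dWu.
rewrite !(mulmxDr, mulmxN) -!scalemxAr.
rewrite !(innerDr, innerNr, innerZr).
have self_skew M : M^T = - M -> inner u (M *m u) *+ 2 = 0.
  by move=> skewM; rewrite mulr2n {1}inner_skew // addNr.
rewrite !mulrnBl !self_skew // !subr0.
move: (V *m (W *m u)) (W *m (V *m u)) (V *m d u) (W *m d u) (W *m d (d P))
  (V *m d (d Q)) (V *m Q) (W *m P) => x1 x2 x3 x4 x5 x6 x7 x8.
rewrite !dZ Ds Dt !(dD, dZ) ?(raddfD D) !D_inner ?(dD, dZ) Ds Dt.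
rewrite ?(raddfD D) /= ?D_inner.
(* One orientation for every inner product, so that equal ones coincide. *)
rewrite !(innerC _ u) ?(innerC P, innerC (d P), innerC (d (d P))).
rewrite ?(innerC Q, innerC (d Q) (d u), innerC (d (d Q))).
apply/matrixP=> i j; rewrite !mxE.
ring.
Qed.

End DifferentialIdentities.

(** * Integration on the functions without constant term *)

Section FormalIntegration.

Variables (K : numFieldType) (A : comAlgType K) (cst : {lrmorphism A -> K | *%R}).
Variables (D I : {linear A -> A}) (hI : formal_integration cst D I).

Lemma cst_deriv_mx m p (M : 'M[A]_(m, p)) : map_mx cst (map_mx D M) = 0.
Proof. by apply/matrixP=> i j; rewrite !mxE (cst_deriv hI). Qed.

Lemma cst_int_mx m p (M : 'M[A]_(m, p)) :
  map_mx cst M = 0 -> map_mx cst (map_mx I M) = 0.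
Proof.
move=> /matrixP M0; apply/matrixP=> i j; move: (M0 i j).
by rewrite !mxE => /(cst_int hI).
Qed.

Lemma deriv_intK_mx m p (M : 'M[A]_(m, p)) :
  map_mx cst M = 0 -> map_mx D (map_mx I M) = M.
Proof.
move=> /matrixP M0; apply/matrixP=> i j; move: (M0 i j).
by rewrite !mxE => /(deriv_intK hI).
Qed.

Lemma int_derivK_mx m p (M : 'M[A]_(m, p)) :
  map_mx cst M = 0 -> map_mx I (map_mx D M) = M.
Proof.
move=> /matrixP M0; apply/matrixP=> i j; move: (M0 i j).
by rewrite !mxE => /(int_derivK hI).
Qed.

Variables (n : nat) (u P Q : 'cV[A]_n).
Hypotheses (hu : map_mx cst u = 0) (hP : map_mx cst P = 0) (hQ : map_mx cst Q = 0).

Local Notation S X := (I (inner u X)).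
Local Notation W X := (map_mx I (wedge X (map_mx D u))).

Let cst_inner (x y : 'cV[A]_n) : map_mx cst x = 0 -> cst (inner x y) = 0.
Proof.
by move=> x0; rewrite map_inner /= x0 innerC innerE mulmx0 mxE.
Qed.

Let cst_wedge (x y : 'cV[A]_n) : map_mx cst x = 0 -> map_mx cst (wedge x y) = 0.
Proof.
move=> x0; rewrite map_wedge /= x0.
by apply/matrixP=> i j; rewrite !mxE mul0r mulr0 subr0.
Qed.

Let skewI (x y : 'cV[A]_n) :
  (map_mx I (wedge x y))^T = - map_mx I (wedge x y).
Proof. by rewrite map_trmx tr_wedge map_mxN. Qed.

(** The two integrals of [wedge Q P_x] and [wedge P Q_x] combine by integration
    by parts, which is legitimate as [wedge Q P] has no constant term. *)
Lemma frechet_commutatorE :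
  frechet (@recursion_op n) D I u P Q - frechet (@recursion_op n) D I u Q P =
  frechet_commutator D u P Q (S P) (S Q) (W P) (W Q).
Proof.
have swapI : map_mx I (wedge P (map_mx D Q)) =
    map_mx I (wedge Q (map_mx D P)) - wedge Q P.
  have <- : map_mx I (map_mx D (wedge Q P)) = wedge Q P.
    exact/int_derivK_mx/cst_wedge.
  rewrite -map_mxB; congr (map_mx I _).
  apply/matrixP=> i j; rewrite !mxE raddfB /= !(deriv_leibniz hI); ring.
rewrite !frechetE swapI mulmxBl mul_wedge (innerC P Q) (innerC P u) (innerC Q u).
rewrite /frechet_commutator.
move: (_ *m u) (_ *m P) (_ *m Q) => v w x.
by apply/matrixP=> i j; rewrite !mxE; ring.
Qed.

Local Notation Rop := (recursion_op D I u).

Let RE X : Rop X = recursion_with_potentials D u X (S X) (W X).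
Proof. exact: recursion_opE. Qed.

Let H := frechet_commutator D u P Q (S P) (S Q) (W P) (W Q).
Let alpha := scalar_potential D u P Q (S P) (S Q).
Let beta := matrix_potential D u P Q (S P) (S Q) (W P) (W Q).

Let DS X : D (S X) = inner u X.
Proof. by rewrite (deriv_intK hI) // cst_inner. Qed.

Let dW X : map_mx cst X = 0 -> map_mx D (W X) = wedge X (map_mx D u).
Proof. by move=> X0; rewrite deriv_intK_mx // cst_wedge. Qed.

(** Integrating [D_scalar_potential] and [d_matrix_potential] introduces no
    constants, since every monomial of either potential has a factor without
    constant term. *)
Lemma int_inner_commutator :
  I (inner u H) = alpha + I (inner (Rop P) Q - inner (Rop Q) P).
Proof.
have alpha0 : cst alpha = 0.
  rewrite /alpha /scalar_potential !(raddfD cst, raddfN cst) /= !rmorphM /=.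
  by rewrite !cst_inner ?cst_deriv_mx // !mulr0 oppr0 !addr0.
rewrite -{1}(int_derivK hI alpha0) -raddfD /=; congr (I _).
rewrite (D_scalar_potential (deriv_leibniz hI) (DS P) (DS Q)
  (skewI P (map_mx D u)) (skewI Q (map_mx D u))).
by rewrite -!RE subrK.
Qed.

Lemma int_wedge_commutator :
  map_mx I (wedge H (map_mx D u)) =
  beta + map_mx I (wedge Q (map_mx D (Rop P)) - wedge P (map_mx D (Rop Q))).
Proof.
have beta0 : map_mx cst beta = 0.
  rewrite /beta /matrix_potential !(map_mxB, map_mxD) !map_mxM.
  have W0 X : map_mx cst X = 0 -> map_mx cst (W X) = 0.
    by move=> X0; rewrite cst_int_mx // cst_wedge.
  have Z a M : map_mx cst M = 0 -> map_mx cst (a *: M : 'M_n) = 0.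
    by move=> M0; rewrite map_mxZ M0 scaler0.
  by rewrite !Z ?cst_wedge ?W0 ?cst_deriv_mx // !mulmx0 !subr0 !addr0.
rewrite -{1}(int_derivK_mx beta0) -map_mxD; congr (map_mx I _).
rewrite (d_matrix_potential (deriv_leibniz hI) (DS P) (DS Q) (dW hP) (dW hQ)
  (skewI P (map_mx D u)) (skewI Q (map_mx D u))).
by rewrite -!RE subrK.
Qed.

Lemma hereditary_expr_sym :
  hereditary_expr (@recursion_op n) D I u P Q =
  hereditary_expr (@recursion_op n) D I u Q P.
Proof.
(* Linearity of the operator reduces its two values to that at the commutator. *)
have regroup (a b c e : 'cV[A]_n) : a - c = b - e -> a - b = c - e.
  by move=> eq_ac; rewrite -(subrK c a) eq_ac addrAC [b - e]addrC addrK addrC.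
apply: regroup; rewrite recursion_opB [in LHS]frechet_commutatorE -/H.
rewrite (recursion_opE D I u H) /= int_inner_commutator int_wedge_commutator.
rewrite !frechetE scalerDl mulmxDl.
have add_eq (v w x y : 'cV[A]_n) : v = w -> x - v = y - w -> x = y.
  by move=> -> /addIr.
have := potentials_cancel (deriv_leibniz hI) (DS P) (DS Q) (dW hP) (dW hQ)
  (skewI P (map_mx D u)) (skewI Q (map_mx D u)).
rewrite -!RE -/H -/alpha -/beta.
move/add_eq; apply.
rewrite raddfB map_mxB mulmxBl.
move: (map_mx D (map_mx D H)) (H) (alpha) (beta *m u) (Rop P) (Rop Q).
move=> ddH h a bu RP RQ.
move: (_ *m u) (_ *m u) (_ *m RP) (_ *m RQ) => v w x y.
by apply/matrixP=> i j; rewrite !mxE; ring.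
Qed.

End FormalIntegration.

Theorem proposition3 (n : nat) (K : numFieldType) (A : comAlgType K)
    (cst : {lrmorphism A -> K | *%R}) (D I : {linear A -> A})
    (hI : formal_integration cst D I)
    (u : 'cV[A]_n) (hu : map_mx cst u = 0) :
  hereditary (@recursion_op n) cst D I u.
Proof. by move=> P Q hP hQ; apply: (hereditary_expr_sym hI). Qed.
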